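(* Let $\mathsf{Z}=\sum_{\lambda_1,\lambda_2,\lambda_3}\mathcal{T}_{\lambda_1,\lambda_2,\lambda_3}\,\mathsf{W}_{\lambda_1,\emptyset}\otimes\mathsf{W}_{\lambda_2,\emptyset}\otimes\mathsf{W}_{\lambda_3,\emptyset}$, a formal sum over triples of partitions with coefficients $\mathcal{T}_{\lambda_1,\lambda_2,\lambda_3}$. Then: (1) $\mathsf{A}_1\cdot\mathsf{Z}=0$ if and only if for all triples of partitions both $$s_{\square}(q^{\lambda_2^t+\rho})\,\mathcal{T}_{\lambda_1,\lambda_2,\lambda_3}=\sum_{\alpha_1\in\lambda_1-\square}\mathcal{T}_{\alpha_1,\lambda_2,\lambda_3}-\sum_{\gamma_3\in\lambda_3+\square}q^{(\kappa(\gamma_3)-\kappa(\lambda_3))/2}\,\mathcal{T}_{\lambda_1,\lambda_2,\gamma_3}$$ and $$s_{\square}(q^{\lambda_1+\rho})\,\mathcal{T}_{\lambda_1,\lambda_2,\lambda_3}=\sum_{\beta_2\in\lambda_2-\square}q^{(\kappa(\beta_2)-\kappa(\lambda_2))/2}\,\mathcal{T}_{\lambda_1,\beta_2,\lambda_3}-\sum_{\gamma_3\in\lambda_3+\square}\mathcal{T}_{\lambda_1,\lambda_2,\gamma_3};$$ and similarly for cyclic permutations of the indices $1\to2\to3$, that is: (2) $\mathsf{A}_2\cdot\mathsf{Z}=0$ if and only if for all triples of partitions both $$s_{\square}(q^{\lambda_3^t+\rho})\,\mathcal{T}_{\lambda_1,\lambda_2,\lambda_3}=\sum_{\alpha_2\in\lambda_2-\square}\mathcal{T}_{\lambda_1,\alpha_2,\lambda_3}-\sum_{\gamma_1\in\lambda_1+\square}q^{(\kappa(\gamma_1)-\kappa(\lambda_1))/2}\,\mathcal{T}_{\gamma_1,\lambda_2,\lambda_3}$$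 and $$s_{\square}(q^{\lambda_2+\rho})\,\mathcal{T}_{\lambda_1,\lambda_2,\lambda_3}=\sum_{\beta_3\in\lambda_3-\square}q^{(\kappa(\beta_3)-\kappa(\lambda_3))/2}\,\mathcal{T}_{\lambda_1,\lambda_2,\beta_3}-\sum_{\gamma_1\in\lambda_1+\square}\mathcal{T}_{\gamma_1,\lambda_2,\lambda_3};$$ (3) $\mathsf{A}_3\cdot\mathsf{Z}=0$ if and only if for all triples of partitions both $$s_{\square}(q^{\lambda_1^t+\rho})\,\mathcal{T}_{\lambda_1,\lambda_2,\lambda_3}=\sum_{\alpha_3\in\lambda_3-\square}\mathcal{T}_{\lambda_1,\lambda_2,\alpha_3}-\sum_{\gamma_2\in\lambda_2+\square}q^{(\kappa(\gamma_2)-\kappa(\lambda_2))/2}\,\mathcal{T}_{\lambda_1,\gamma_2,\lambda_3}$$ and $$s_{\square}(q^{\lambda_3+\rho})\,\mathcal{T}_{\lambda_1,\lambda_2,\lambda_3}=\sum_{\beta_1\in\lambda_1-\square}q^{(\kappa(\beta_1)-\kappa(\lambda_1))/2}\,\mathcal{T}_{\beta_1,\lambda_2,\lambda_3}-\sum_{\gamma_2\in\lambda_2+\square}\mathcal{T}_{\lambda_1,\gamma_2,\lambda_3}.$$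
   Context: **Combinatorics.** Partitions are identified with Young diagrams; $\lambda^t$ is the transpose, $\square$ the one-box partition. $\lambda\pm\square$ is the set of partitions obtained from $\lambda$ by adding/removing one box. $\kappa(\lambda)=2\sum_{(i,j)\in\lambda}(j-i)$ (row $i$, column $j$), $C_\lambda(q)=\sum_{(i,j)\in\lambda}q^{j-i}$, $\rho=(-\frac12,-\frac32,\dots)$, and $s_\square(q^{\mu+\rho})=\sum_{i\ge1}q^{\mu_i-i+1/2}=(q^{1/2}-q^{-1/2})C_\mu(q)+\frac{1}{q^{1/2}-q^{-1/2}}$. **Skeins.** Put $z=q^{1/2}-q^{-1/2}$. For an oriented 3-manifold $M$, $\mathrm{Sk}(M)$ is the HOMFLYPT skein module: the module generated by isotopy classes of framed oriented links modulo (positive crossing) $-$ (negative crossing) $=z\cdot$(oriented smoothing), (unknot) $=\frac{a-a^{-1}}{z}$, and a positive (negative) full framing twist equals multiplication by $a$ ($a^{-1}$). $\mathrm{Sk}(\mathbb{R}\times T^2)$ is an algebra by concatenation in the $\mathbb{R}$-direction and acts on $\mathrm{Sk}(S^1\times\mathbb{R}^2)$ by inserting links near the ideal boundary torus. $\mathsf{P}_{i,j}\in\mathrm{Sk}(\mathbb{R}\times T^2)$ (only $\mathsf{P}_{0,0}$ and coprime $(i,j)$ are needed here) is the embedded curve of class $(i,j)$ in $0\times T^2$ framed by the vector field along $\mathbb{R}$; $\mathsf{P}_{0,0}$ is the unknot. The class $(1,0)$ is the meridian, contractible in the solid torus; $(0,1)$ is the chosen longitude. $\mathrm{Sk}(S^1\times\mathbb{R}^2)$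 has a basis $\mathsf{W}_{\lambda,\bar\mu}$ indexed by pairs of partitions, consisting of eigenvectors of $\mathsf{P}_{1,0}$ (with pairwise distinct eigenvalues), scaled so that the HOMFLYPT polynomial of the satellite of the unknot in $S^3$ by $\mathsf{W}_{\lambda,\bar\mu}$ is the quantum dimension of $(\lambda,\bar\mu)$, with $a=q^{N/2}$. The known (Morton–Samuelson) action on $\mathsf{W}_{\lambda,\emptyset}$ is: $\mathsf{P}_{0,0}\mathsf{W}_{\lambda,\emptyset}=\frac{a-a^{-1}}{z}\mathsf{W}_{\lambda,\emptyset}$; $\mathsf{P}_{1,0}\mathsf{W}_{\lambda,\emptyset}=\left(\frac{a-a^{-1}}{z}+a\,z\,C_\lambda(q)\right)\mathsf{W}_{\lambda,\emptyset}$; $\mathsf{P}_{-1,0}\mathsf{W}_{\lambda,\emptyset}=\left(\frac{a-a^{-1}}{z}-a^{-1}z\,C_\lambda(q^{-1})\right)\mathsf{W}_{\lambda,\emptyset}$; $\mathsf{P}_{0,1}\mathsf{W}_{\lambda,\emptyset}=\sum_{\alpha\in\lambda+\square}\mathsf{W}_{\alpha,\emptyset}$; $\mathsf{P}_{-1,1}\mathsf{W}_{\lambda,\emptyset}=\sum_{\beta\in\lambda+\square}a^{-1}q^{(\kappa(\lambda)-\kappa(\beta))/2}\mathsf{W}_{\beta,\emptyset}$; $\mathsf{P}_{0,-1}\mathsf{W}_{\lambda,\emptyset}=\sum_{\gamma\in\lambda-\square}\mathsf{W}_{\gamma,\emptyset}+\mathsf{W}_{\lambda,\overline{\square}}$;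 $\mathsf{P}_{1,-1}\mathsf{W}_{\lambda,\emptyset}=a\sum_{\gamma\in\lambda-\square}q^{(\kappa(\lambda)-\kappa(\gamma))/2}\mathsf{W}_{\gamma,\emptyset}+a^{-1}\mathsf{W}_{\lambda,\overline{\square}}$. **Operators.** Take three solid tori with common variable $q$ and separate variables $a_1,a_2,a_3$; $\mathsf{P}^{(k)}_{i,j}$ acts on the $k$-th tensor factor (with $a=a_k$). Set \begin{align*} \mathsf{A}_1&=a_1^{-1}(\mathsf{P}^{(1)}_{0,0}-\mathsf{P}^{(1)}_{1,0}-a_1a_3^2\mathsf{P}^{(1)}_{0,1})+a_2a_3^2(\mathsf{P}^{(2)}_{0,0}+a_3^{-2}\mathsf{P}^{(2)}_{-1,1}-\mathsf{P}^{(2)}_{-1,0})+(a_3\mathsf{P}^{(3)}_{0,0}-\mathsf{P}^{(3)}_{0,-1}+a_3\mathsf{P}^{(3)}_{1,-1}),\\ \mathsf{A}_2&=a_2^{-1}(\mathsf{P}^{(2)}_{0,0}-\mathsf{P}^{(2)}_{1,0}-a_2a_1^2\mathsf{P}^{(2)}_{0,1})+a_3a_1^2(\mathsf{P}^{(3)}_{0,0}+a_1^{-2}\mathsf{P}^{(3)}_{-1,1}-\mathsf{P}^{(3)}_{-1,0})+(a_1\mathsf{P}^{(1)}_{0,0}-\mathsf{P}^{(1)}_{0,-1}+a_1\mathsf{P}^{(1)}_{1,-1}),\\ \mathsf{A}_3&=a_3^{-1}(\mathsf{P}^{(3)}_{0,0}-\mathsf{P}^{(3)}_{1,0}-a_3a_2^2\mathsf{P}^{(3)}_{0,1})+a_1a_2^2(\mathsf{P}^{(1)}_{0,0}+a_2^{-2}\mathsf{P}^{(1)}_{-1,1}-\mathsf{P}^{(1)}_{-1,0})+(a_2\mathsf{P}^{(2)}_{0,0}-\mathsf{P}^{(2)}_{0,-1}+a_2\mathsf{P}^{(2)}_{1,-1}).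 \end{align*} They act termwise on formal infinite sums of basis elements.
   Formalization: The coefficients T are taken in a field containing q^{1/2} and independent of a_1, a_2, a_3; if T may depend on the a_k, the ''only if'' directions fail, since the single equation from A_1·Z=0 no longer splits into the two recursions. *)

(* Defs.v *)
From HB Require Import structures.
From mathcomp Require Import all_boot all_order all_algebra generic_quotient ring_quotient.
From mathcomp Require Import all_classical all_reals all_analysis.
From mathcomp Require Import freeg.
From mathcomp Require Import -(notations) mpoly.
Import Order.TTheory GRing.Theory Num.Theory.
Import numFieldNormedType.Exports.

Set Implicit Arguments.
Unset Strict Implicit.
Unset Printing Implicit Defensive.

Local Open Scope classical_set_scope.
Local Open Scope ring_scope.

Definition is_part (l : seq nat) : bool := sorted geq l && (0%N \notin l).

Definition intpart : Type := {l : seq nat | is_part l}.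

Definition empty_part : intpart := Sub [::] isT.

Definition box_part : intpart := Sub [:: 1%N] isT.

Definition conj_seq (l : seq nat) : seq nat :=
  [seq count (ltn j) l | j <- iota 0 (head 0%N l)].

Lemma conj_seq_part (l : intpart) : is_part (conj_seq (val l)).
Proof.
case: l => l /= /andP[_ _]; apply/andP; split.
  rewrite sorted_map; apply: (@sub_sorted _ leq); last exact: iota_sorted.
  by move=> i j ij /=; apply: sub_count => x /=; apply: leq_ltn_trans.
apply/mapP => -[j]; rewrite mem_iota /= add0n; case: l => [//|x l] /= jx.
by rewrite jx.
Qed.

Definition conj_part (l : intpart) : intpart := Sub _ (conj_seq_part l).

Definition add_box (l : intpart) : set intpart :=
  [set m | exists i, val m = incr_nth (val l) i].

Definition rem_box (l : intpart) : set intpart := [set m | add_box m l].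

Definition kappa (l : intpart) : int :=
  2 * \sum_(i < size (val l)) \sum_(j < nth 0%N (val l) i) (j%:Z - i%:Z).

Definition content_gen (F : fieldType) (l : intpart) (q : F) : F :=
  \sum_(i < size (val l)) \sum_(j < nth 0%N (val l) i) q ^ (j%:Z - i%:Z).

(* [s] stands for q^(1/2); the series sum_i q^(mu_i - i + 1/2) is taken in its
   closed form. *)
Definition schur_box (F : fieldType) (s : F) (m : intpart) : F :=
  (s - s^-1) * content_gen m (s ^+ 2) + (s - s^-1)^-1.

Section Span.
Variables (F : fieldType) (V : lmodType F) (G : V -> Prop).

Inductive span : V -> Prop :=
| span0 : span 0
| spanDZ c u v : G u -> span v -> span (c *: u + v).

Definition span_pred : {pred V} := fun v => `[< span v >].

Lemma span_submod : submod_closed span_pred.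
Proof.
split=> [|c u v]; first by apply/asboolP; exact: span0.
move=> /asboolP hu /asboolP hv; apply/asboolP; elim: hu => [|d x y Gx _ IH].
  by rewrite scaler0 add0r.
by rewrite scalerDr scalerA -addrA; exact: spanDZ.
Qed.

HB.instance Definition _ := GRing.isSubmodClosed.Build F V span_pred span_submod.

Definition quotmod : Type := Quotient.quot span_pred.

HB.instance Definition _ := GRing.Zmodule.on quotmod.

Definition quot_proj (v : V) : quotmod := \pi_(Quotient.quot span_pred)%qT v.

Definition quot_repr (x : quotmod) : V := repr (x : Quotient.quot span_pred).

Definition quot_scale (c : F) (x : quotmod) : quotmod :=
  quot_proj (c *: quot_repr x).

Lemma quot_reprK x : quot_proj (quot_repr x) = x.
Proof. exact: reprK. Qed.

Lemma quot_projP u v : quot_proj u = quot_proj v <-> span (u - v).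
Proof.
split=> [h|h]; last first.
  by apply/eqP; rewrite -Quotient.idealrBE; apply/asboolP.
by apply/asboolP; have /eqP := h; rewrite -Quotient.idealrBE.
Qed.

Lemma quot_projD u v : quot_proj (u + v) = quot_proj u + quot_proj v.
Proof. by rewrite /quot_proj; exact: raddfD. Qed.

Lemma quot_projZ c v : quot_proj (c *: v) = quot_scale c (quot_proj v).
Proof.
apply/quot_projP/asboolP; rewrite -scalerBr -[_ *: _]addr0.
apply: (span_submod.2); last exact: span_submod.1.
by apply/asboolP/quot_projP; rewrite quot_reprK.
Qed.

Lemma quot_scaleA a b x : quot_scale a (quot_scale b x) = quot_scale (a * b) x.
Proof. by rewrite -(quot_reprK x) -!quot_projZ scalerA. Qed.

Lemma quot_scale1 : left_id 1 quot_scale.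
Proof. by move=> x; rewrite -(quot_reprK x) -quot_projZ scale1r. Qed.

Lemma quot_scaleDr : right_distributive quot_scale +%R.
Proof.
move=> c x y; rewrite -(quot_reprK x) -(quot_reprK y) -quot_projD -!quot_projZ.
by rewrite scalerDr quot_projD.
Qed.

Lemma quot_scaleDl x : {morph quot_scale^~ x : a b / a + b}.
Proof.
by move=> a b; rewrite -(quot_reprK x) -!quot_projZ scalerDl quot_projD.
Qed.

HB.instance Definition _ := GRing.Zmodule_isLmodule.Build F quotmod
  quot_scaleA quot_scale1 quot_scaleDr quot_scaleDl.

End Span.


Section Lift.
Variables (F : fieldType) (X : choiceType) (G : {freeg X / F} -> Prop).

Definition gen (x : X) : {freeg X / F} := << x >>.

(* Extends [f] linearly; this is a linear map exactly when the linear extension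
   of [f] to the free module kills the relations [G]. *)
Definition lift_gen (V : lmodType F) (f : X -> V) (x : quotmod G) : V :=
  fglift f (quot_repr x).

End Lift.

Section Tensor.
Variable F : fieldType.

Inductive multilinear (U V W : lmodType F) : {freeg (U * V * W) / F} -> Prop :=
| Multilin1 c u u' v w : multilinear
    (gen F (c *: u + u', v, w) - c *: gen F (u, v, w) - gen F (u', v, w))
| Multilin2 c u v v' w : multilinear
    (gen F (u, c *: v + v', w) - c *: gen F (u, v, w) - gen F (u, v', w))
| Multilin3 c u v w w' : multilinear
    (gen F (u, v, c *: w + w') - c *: gen F (u, v, w) - gen F (u, v, w')).

Definition tensor3 (U V W : lmodType F) : lmodType F :=
  quotmod (@multilinear U V W).

Definition tens (U V W : lmodType F) (u : U) (v : V) (w : W) : tensor3 U V W :=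
  quot_proj _ (gen F (u, v, w)).

Definition tens_map (U V W : lmodType F) (f : U -> U) (g : V -> V) (h : W -> W)
    (x : tensor3 U V W) : tensor3 U V W :=
  lift_gen (fun y : U * V * W => tens (f y.1.1) (g y.1.2) (h y.2)) x.

End Tensor.

Section FormalSums.
Variables (F : fieldType) (V : lmodType F) (I : choiceType).

Definition expansion (E : I -> V) (x : V) (c : I -> F) : Prop :=
  finite_set [set i | c i != 0] /\ x = \sum_(i \in [set: I]) c i *: E i.

Definition is_basis (E : I -> V) : Prop := forall x, exists! c, expansion E x c.

(* Vanishing of the formal, possibly infinite, sum of the [t j *: v j]: with
   [M j] the coordinates of [v j] in [E], each basis vector receives finitely
   many contributions and these cancel. *)
Definition formal_sum_eq0 (J : choiceType) (E : I -> V) (t : J -> F)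
    (v : J -> V) : Prop :=
  exists M : J -> I -> F,
    (forall j, expansion E (v j) (M j)) /\
    (forall i, finite_set [set j | t j * M j i != 0] /\
               \sum_(j \in [set: J]) t j * M j i = 0).

End FormalSums.

Section Links.
Variable R : realType.

Notation vec := 'rV[R]_3.

Definition vec3 (x y z : R) : vec := \row_(i < 3) [:: x; y; z]`_i.

Definition crossv (u v : vec) : vec :=
  vec3 (u 0 1 * v 0 2 - u 0 2 * v 0 1)
       (u 0 2 * v 0 0 - u 0 0 * v 0 2)
       (u 0 0 * v 0 1 - u 0 1 * v 0 0).

(* The manifolds are the quotients of R^3, with its standard orientation, by
   the lattice of integer vectors supported on a set [D] of coordinates. *)
Definition lattice (D : {set 'I_3}) : set vec :=
  [set l | forall i, if i \in D then l 0 i \is a Num.int else l 0 i == 0].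

(* S^1 x R^2 : the S^1 coordinate comes first *)
Definition solid_torus : {set 'I_3} := [set 0].

(* R x T^2 : the R coordinate is the second one, the first and third ones are
   the longitudinal and the meridional coordinates on T^2. *)
Definition thick_torus : {set 'I_3} := [set 0; 2].

(* An oriented framed curve is encoded by the set of all (point, positive
   multiple of the velocity, framing vector), over all lifts to R^3. *)
Definition curve_set (D : {set 'I_3}) (T : set R) (c f : R -> vec) :
    set (vec * vec * vec) :=
  [set x | exists t l k, [/\ T t, lattice D l, 0 < k &
     x = (c t + l, k *: derive1 c t, f t)]].

Definition link_set (D : {set 'I_3}) n (c f : 'I_n -> R -> vec) :
    set (vec * vec * vec) :=
  \bigcup_i curve_set D setT (c i) (f i).

Record link_param (D : {set 'I_3}) n (c f : 'I_n -> R -> vec) : Prop := {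
  lp_closed : forall i, exists2 l, lattice D l &
    forall t, c i (t + 1) = c i t + l;
  lp_framing_closed : forall i t, f i (t + 1) = f i t;
  lp_derivable : forall i t, derivable (c i) t 1;
  lp_C1 : forall i, continuous (derive1 (c i));
  lp_framing_cont : forall i, continuous (f i);
  lp_framed : forall i t, row_free (col_mx (derive1 (c i) t) (f i t));
  lp_embedded : forall i j s t,
    lattice D (c i s - c j t) -> i = j /\ (s - t) \is a Num.int }.

Definition framed_link (D : {set 'I_3}) : set (set (vec * vec * vec)) :=
  [set S | exists n (c f : 'I_n -> R -> vec),
     link_param D c f /\ S = link_set D c f].

Definition isotopic (D : {set 'I_3}) (S S' : set (vec * vec * vec)) : Prop :=
  exists n (c f : R -> 'I_n -> R -> vec),
    let cont (g : R -> 'I_n -> R -> vec) := forall i,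
      {within [set ut : R * R | 0 <= ut.1 <= 1],
        continuous (fun ut => g ut.1 i ut.2)} in
    [/\ forall u, 0 <= u <= 1 -> link_param D (c u) (f u),
        [/\ cont c, cont (fun u i => derive1 (c u i)) & cont f],
        S = link_set D (c 0) (f 0) & S' = link_set D (c 1) (f 1)].

(* A ball in which local relations are imposed *)
Definition in_box (D : {set 'I_3}) : set (vec * vec * vec) :=
  [set x : vec * vec * vec |
     exists2 l, lattice D l & forall i, `|x.1.1 0 i - l 0 i| < 1 / 4].

Definition upward (_ : R) : vec := vec3 0 0 1.

(* Two C^1 arcs crossing the box, which agree to first order at its boundary
   with the two straight arcs [flat_arc (+-1)]; seen from z = +oo. *)
Definition arc (y z : R) (t : R) : vec :=
  let u := 4 * t in
  vec3 t (y / 8 * ((3 * u - u ^+ 3) / 2)) (z / 8 * (1 - u ^+ 2) ^+ 2).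

Definition flat_arc (y : R) (t : R) : vec := vec3 t (y / 8) 0.

Definition two_arcs (D : {set 'I_3}) (c c' : R -> vec) :
    set (vec * vec * vec) :=
  let T := [set t : R | `|t| < 1 / 4] in
  curve_set D T c upward `|` curve_set D T c' upward.

Definition positive_crossing D := two_arcs D (arc 1 (-1)) (arc (-1) 1).
Definition negative_crossing D := two_arcs D (arc 1 1) (arc (-1) (-1)).
Definition smoothing D := two_arcs D (flat_arc 1) (flat_arc (-1)).

Definition skein_triple (D : {set 'I_3}) (Sp Sm S0 : set (vec * vec * vec)) :=
  [/\ Sp `\` in_box D = S0 `\` in_box D /\ Sm `\` in_box D = S0 `\` in_box D,
      Sp `&` in_box D = positive_crossing D,
      Sm `&` in_box D = negative_crossing D &
      S0 `&` in_box D = smoothing D].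

Definition small_circle (t : R) : vec :=
  vec3 (cos (2 * pi * t) / 8) (sin (2 * pi * t) / 8) 0.

Definition add_unknot (D : {set 'I_3}) (S S' : set (vec * vec * vec)) : Prop :=
  S `&` in_box D = set0 /\ S' = S `|` curve_set D setT small_circle upward.

(* [S'] is [S] with one positive (right-handed) full twist inserted in the
   framing of one component. *)
Definition add_twist (D : {set 'I_3}) (S S' : set (vec * vec * vec)) : Prop :=
  exists n (c f : 'I_n -> R -> vec) (i : 'I_n),
    let f' := fun j t => if j == i then
      cos (2 * pi * t) *: f j t + sin (2 * pi * t) *: crossv (derive1 (c j) t) (f j t)
      else f j t in
    [/\ link_param D c f, S = link_set D c f & S' = link_set D c f'].

Variables (F : fieldType) (z a : F).

Section Skein.
Variable D : {set 'I_3}.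

Notation links := (framed_link D : Type).
Notation "[[ S ]]" := (gen F (S : links)).

Inductive skein_rel : {freeg links / F} -> Prop :=
| Isotopy (S S' : links) : isotopic D (val S) (val S') ->
    skein_rel ([[S]] - [[S']])
| Crossing (Sp Sm S0 : links) : skein_triple D (val Sp) (val Sm) (val S0) ->
    skein_rel ([[Sp]] - [[Sm]] - z *: [[S0]])
| Unknot (S S' : links) : add_unknot D (val S) (val S') ->
    skein_rel ([[S']] - ((a - a^-1) / z) *: [[S]])
| Twist (S S' : links) : add_twist D (val S) (val S') ->
    skein_rel ([[S']] - a *: [[S]]).

Definition skein : lmodType F := quotmod skein_rel.

Definition link_class (S : links) : skein := quot_proj _ [[S]].

(* Total version of [link_class]; the default value is for sets which are not
   framed links. *)
Definition set_class (S : set (vec * vec * vec)) : skein :=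
  if pselect (framed_link D S) is left h then link_class (SigSub (mem_set h))
  else 0.

End Skein.

(* The orientation preserving embedding of R x T^2 onto the complement of the
   core of S^1 x R^2, precomposed with the translation by [h] along R. *)
Definition collar (h : R) (p : vec) : vec :=
  let r := expR (p 0 1 + h) in
  vec3 (p 0 0) (r * cos (2 * pi * p 0 2)) (r * sin (2 * pi * p 0 2)).

Definition push (g : vec -> vec) (S : set (vec * vec * vec)) :
    set (vec * vec * vec) :=
  [set (g x.1.1, 'D_(x.1.2) g x.1.1, 'D_(x.2) g x.1.1) | x in S].

Definition radius2 (x : vec * vec * vec) : R := x.1.1 0 1 ^+ 2 + x.1.1 0 2 ^+ 2.

Record insertion_action
    (act : skein thick_torus -> skein solid_torus -> skein solid_torus) :
    Prop := {
  act_linear_l : forall c x y w, act (c *: x + y) w = c *: act x w + act y w;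
  act_linear_r : forall x c v w, act x (c *: v + w) = c *: act x v + act x w;
  act_insert : forall (h rho : R) (K : framed_link thick_torus)
      (L M : framed_link solid_torus),
    (forall x, val L x -> radius2 x < rho) ->
    (forall x, push (collar h) (val K) x -> rho < radius2 x) ->
    val M = val L `|` push (collar h) (val K) ->
    act (link_class K) (link_class L) = link_class M }.

(* The curve on 0 x T^2 of class [i] times the meridian plus [j] times the
   longitude, for [(i, j)] coprime or null. *)
Definition torus_curve (i j : int) (t : R) : vec :=
  if (i == 0) && (j == 0) then
    vec3 (cos (2 * pi * t) / 8) 0 (sin (2 * pi * t) / 8)
  else vec3 (j%:~R * t) 0 (i%:~R * t).

Definition Pcurve (i j : int) : skein thick_torus :=
  set_class thick_torus
    (curve_set thick_torus setT (torus_curve i j) (fun=> vec3 0 1 0)).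

(* [W l m] is W_(l, bar m) and [s] is q^(1/2). The last fields are the
   Morton-Samuelson formulas. [sb_empty] and [sb_01] fix the scale of the
   [W l empty_part], and [sb_0N1] that of the [W l box_part]. *)
Record skein_basis (s : F)
    (act : skein thick_torus -> skein solid_torus -> skein solid_torus)
    (W : intpart -> intpart -> skein solid_torus) : Prop := {
  sb_basis : is_basis (fun lm : intpart * intpart => W lm.1 lm.2);
  sb_eigen : exists2 e : intpart * intpart -> F, injective e &
    forall l m, act (Pcurve 1 0) (W l m) = e (l, m) *: W l m;
  sb_empty : W empty_part empty_part = set_class solid_torus set0;
  sb_00 : forall l, act (Pcurve 0 0) (W l empty_part) =
    ((a - a^-1) / z) *: W l empty_part;
  sb_10 : forall l, act (Pcurve 1 0) (W l empty_part) =
    ((a - a^-1) / z + a * z * content_gen l (s ^+ 2)) *: W l empty_part;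
  sb_N10 : forall l, act (Pcurve (-1) 0) (W l empty_part) =
    ((a - a^-1) / z - a^-1 * z * content_gen l (s ^- 2)) *: W l empty_part;
  sb_01 : forall l, act (Pcurve 0 1) (W l empty_part) =
    \sum_(b \in add_box l) W b empty_part;
  sb_N11 : forall l, act (Pcurve (-1) 1) (W l empty_part) =
    \sum_(b \in add_box l) (a^-1 * s ^ (kappa l - kappa b)) *: W b empty_part;
  sb_0N1 : forall l, act (Pcurve 0 (-1)) (W l empty_part) =
    \sum_(c \in rem_box l) W c empty_part + W l box_part;
  sb_1N1 : forall l, act (Pcurve 1 (-1)) (W l empty_part) =
    a *: (\sum_(c \in rem_box l) s ^ (kappa l - kappa c) *: W c empty_part)
    + a^-1 *: W l box_part }.

End Links.

Section Vertex.
Variables (R : realType) (K : fieldType) (s : K).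

Definition coef_field : fieldType := {fraction (mpoly.mpoly 3 K)}.

Definition coef (c : K) : coef_field := tofrac (mpoly.mpolyC 3 c).

(* The framing variables of the three solid tori, numbered from 0 *)
Definition framing_var (k : 'I_3) : coef_field :=
  tofrac (mpoly.mpolyX K (mpoly.mnm1 k)).

Definition leg_skein (D : {set 'I_3}) (k : 'I_3) : lmodType coef_field :=
  skein R (coef s - (coef s)^-1) (framing_var k) D.

Definition vertex_skein : lmodType coef_field :=
  tensor3 (leg_skein solid_torus 0) (leg_skein solid_torus 1)
    (leg_skein solid_torus 2).

Variable act : forall k : 'I_3,
  leg_skein thick_torus k -> leg_skein solid_torus k -> leg_skein solid_torus k.

Definition Pact (k : 'I_3) (i j : int) :
    leg_skein solid_torus k -> leg_skein solid_torus k :=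
  act (Pcurve R _ _ i j).

Definition P1 (i j : int) : vertex_skein -> vertex_skein :=
  tens_map (@Pact 0 i j) id id.
Definition P2 (i j : int) : vertex_skein -> vertex_skein :=
  tens_map id (@Pact 1 i j) id.
Definition P3 (i j : int) : vertex_skein -> vertex_skein :=
  tens_map id id (@Pact 2 i j).

Definition A1 (v : vertex_skein) : vertex_skein :=
  let a1 := framing_var 0 in let a2 := framing_var 1 in
  let a3 := framing_var 2 in
  a1^-1 *: (P1 0 0 v - P1 1 0 v - (a1 * a3 ^+ 2) *: P1 0 1 v)
  + (a2 * a3 ^+ 2) *: (P2 0 0 v + a3 ^- 2 *: P2 (-1) 1 v - P2 (-1) 0 v)
  + (a3 *: P3 0 0 v - P3 0 (-1) v + a3 *: P3 1 (-1) v).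

Definition A2 (v : vertex_skein) : vertex_skein :=
  let a1 := framing_var 0 in let a2 := framing_var 1 in
  let a3 := framing_var 2 in
  a2^-1 *: (P2 0 0 v - P2 1 0 v - (a2 * a1 ^+ 2) *: P2 0 1 v)
  + (a3 * a1 ^+ 2) *: (P3 0 0 v + a1 ^- 2 *: P3 (-1) 1 v - P3 (-1) 0 v)
  + (a1 *: P1 0 0 v - P1 0 (-1) v + a1 *: P1 1 (-1) v).

Definition A3 (v : vertex_skein) : vertex_skein :=
  let a1 := framing_var 0 in let a2 := framing_var 1 in
  let a3 := framing_var 2 in
  a3^-1 *: (P3 0 0 v - P3 1 0 v - (a3 * a2 ^+ 2) *: P3 0 1 v)
  + (a1 * a2 ^+ 2) *: (P1 0 0 v + a2 ^- 2 *: P1 (-1) 1 v - P1 (-1) 0 v)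
  + (a2 *: P2 0 0 v - P2 0 (-1) v + a2 *: P2 1 (-1) v).

Variable W : forall k : 'I_3, intpart -> intpart -> leg_skein solid_torus k.

Definition Wtens (x : (intpart * intpart) * (intpart * intpart) * (intpart * intpart)) :
    vertex_skein :=
  tens (W 0 x.1.1.1 x.1.1.2) (W 1 x.1.2.1 x.1.2.2) (W 2 x.2.1 x.2.2).

Definition Wvertex (l : intpart * intpart * intpart) : vertex_skein :=
  Wtens ((l.1.1, empty_part), (l.1.2, empty_part), (l.2, empty_part)).

(* [T] takes its values in the subfield of constants: it does not depend on the
   framing variables. [A] acting termwise on the formal sum [Z] of the [T l1 l2 l3] times
   [Wvertex (l1, l2, l3)] gives zero. *)
Definition annihilates (A : vertex_skein -> vertex_skein)
    (T : intpart -> intpart -> intpart -> K) : Prop :=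
  formal_sum_eq0 Wtens (fun l => coef (T l.1.1 l.1.2 l.2))
    (fun l => A (Wvertex l)).

End Vertex.

(* Main.v *)
Require Import Defs.
From HB Require Import structures.
From mathcomp Require Import all_boot all_order all_algebra.
From mathcomp Require Import all_classical all_reals all_analysis.
From mathcomp Require Import ring.
From mathcomp Require Import freeg.
From mathcomp Require Import -(notations) mpoly.
Import Order.TTheory GRing.Theory Num.Theory.

Set Implicit Arguments.
Unset Strict Implicit.
Unset Printing Implicit Defensive.

Local Open Scope classical_set_scope.
Local Open Scope ring_scope.

(** The coefficient of a basis vector in A Z is a finite sum, because every
    partition has finitely many neighbours in the Young graph, and the formula
    for that coefficient can be read off from the Morton-Samuelson formulas.

    Number the legs so that the operator is A_1, write (l1, l2, l3) for a
    triple and b = a_3. Acting on the basis vector of that triple, the first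
    bracket of A_1 gives
      - z C_(l1)(q) W_(l1) - b^2 (sum over l1 with a box added),
    the second one
      b^2 z C_(l2)(1/q) W_(l2) + (twisted sum over l2 with a box added),
    and the third one
      ((b^2 - 1) / z) W_(l3)
        + b^2 (twisted sum over l3 with a box removed)
        - (sum over l3 with a box removed),
    where the twist is by powers of q^(1/2) recording the change of kappa.
    The combination of P_(0,-1) and P_(1,-1) in the third bracket is the one
    that cancels the vectors W_(l3, bar box), so that the result stays in
    the span of the W_(l, empty). Powers of a_1 and a_2 have disappeared
    ([leg_growth], [leg_twisted_growth], [leg_decay]).

    Transposing this sparse infinite matrix exchanges adding and removing
    boxes, and the coefficient of A_1 Z at a triple is x + b^2 y, where x and y
    only involve q and the numbers T: up to sign, x is the defect of the second
    recursion and y that of the first one, since C_(l2)(1/q) is the content generating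
    function of the transpose of l2 ([collects_vertex_operator],
    [content_gen_conj]). As T does not depend on the framing variables,
    x + b^2 y = 0 forces x = y = 0 ([coef_framing_eq0]).

    Two foundational facts make this reading of coefficients legitimate. The
    tensor product is defined as a quotient of a free module, so one has to
    know that operators act on pure tensors factor by factor ([tens_mapE]) and
    that tensors of basis vectors are still linearly independent, which is seen
    by pairing them with products of coordinate functionals
    ([tens_expansion_uniq]).

    The cyclic symmetry is handled by stating what is used about a solid
    torus as a predicate on a family of operators ([leg]), which the three
    tensor factors satisfy; the three parts of the theorem are then three
    instances of a single statement ([annihilatesP]). *)

(** * Linear maps out of a quotient of a free module *)

Section Lift.
Variables (F : fieldType) (X : choiceType) (V : lmodType F) (f : X -> V).

HB.instance Definition _ :=
  GRing.isZmodMorphism.Build {freeg X / F} V (fglift f) (lift_is_additive f).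

Lemma fglift_scalable : scalable (fglift f : {freeg X / F} -> V).
Proof.
move=> c D; elim/freeg_ind_dom0 : D => [|k x D _ _ IH].
  by rewrite scaler0 raddf0 scaler0.
rewrite scalerDr !raddfD /= IH; congr (_ + _).
have -> : c *: << k *g x >> = << c * k *g x >> :> {freeg X / F}.
  by apply/eqP/freeg_eqP => y; rewrite coeffZ !coeffU mulrA.
by rewrite !liftU scalerA.
Qed.

HB.instance Definition _ :=
  GRing.isScalable.Build F {freeg X / F} V *:%R (fglift f) fglift_scalable.

Lemma fglift_gen x : fglift f (gen F x) = f x.
Proof. by rewrite /gen liftU scale1r. Qed.

Variable G : {freeg X / F} -> Prop.
Hypothesis fG : forall D, G D -> fglift f D = 0.

(** The representative chosen by [lift_gen] differs from [D] by a combination of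
    relations, which the linear extension of [f] kills. *)
Lemma lift_gen_proj D : lift_gen f (quot_proj G D) = fglift f D.
Proof.
have h v : Defs.span G v -> fglift f v = 0.
  elim=> [|c x y Gx _ IH]; first exact: linear0.
  by rewrite linearP /= (fG Gx) IH scaler0 addr0.
apply/eqP; rewrite -subr_eq0 /lift_gen -linearB; apply/eqP/h.
by apply/quot_projP; rewrite quot_reprK.
Qed.

Lemma lift_gen_linear : linear (lift_gen f : quotmod G -> V).
Proof.
move=> c x y; rewrite -(quot_reprK x) -(quot_reprK y).
have -> : c *: quot_proj G (quot_repr x) + quot_proj G (quot_repr y) =
    quot_proj G (c *: quot_repr x + quot_repr y).
  by rewrite quot_projD quot_projZ.
by rewrite !lift_gen_proj; exact: linearP.
Qed.

End Lift.

(** * Coordinates in a basis *)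

Lemma fsum_supp (V : nmodType) (I : choiceType) (S : set I) (f : I -> V) :
  (forall i, ~ S i -> f i = 0) ->
  \sum_(i \in [set: I]) f i = \sum_(i \in S) f i.
Proof.
by move=> f0; apply/esym/fsbig_widen => // i [_ Si]; rewrite /= f0.
Qed.

Lemma linear_map_fsum (F : fieldType) (U V : lmodType F) (I : choiceType)
    (S : set I) (f : I -> U) (g : U -> V) :
  linear g -> finite_set S ->
  g (\sum_(i \in S) f i) = \sum_(i \in S) g (f i).
Proof.
move=> gl fS; pose gL := GRing.isLinear.Build _ _ _ _ g gl.
pose g' : {linear U -> V} := HB.pack g gL.
by rewrite !fsbig_finite // -[g]/(g' : _ -> _) linear_sum.
Qed.

Lemma scaler_fsumr (F : fieldType) (V : lmodType F) (I : choiceType) (c : F)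
    (S : set I) (k : I -> F) (f : I -> V) : finite_set S ->
  c *: (\sum_(i \in S) k i *: f i) = \sum_(i \in S) (c * k i) *: f i.
Proof.
move=> fS; rewrite !fsbig_finite // scaler_sumr.
by apply: eq_bigr => i _; rewrite scalerA.
Qed.

Section Expansion.
Variables (F : fieldType) (V : lmodType F) (I : choiceType) (E : I -> V).

Lemma expansion_sum (S : set I) (x : V) (c : I -> F) : finite_set S ->
  (forall i, ~ S i -> c i = 0) -> x = \sum_(i \in S) c i *: E i ->
  expansion E x c.
Proof.
move=> fS c0 ->; split; last first.
  by apply/esym/fsum_supp => i /c0 ->; rewrite scale0r.
by apply: sub_finite_set fS => i /=; apply: contra_neqP => /c0.
Qed.

Lemma expansion_patch (S : set I) (c : I -> F) : finite_set S ->
  expansion E (\sum_(i \in S) c i *: E i) (patch (fun=> 0) S c).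
Proof.
move=> fS; apply: (expansion_sum fS) => [i nS|].
  by rewrite patchN // notin_setE.
by apply: eq_fsbigr => i Si; rewrite patchT.
Qed.

Lemma expansionP a x y c d : expansion E x c -> expansion E y d ->
  expansion E (a *: x + y) (fun i => a * c i + d i).
Proof.
move=> [fc ->] [fd ->].
pose S := [set i | c i != 0] `|` [set i | d i != 0].
have fS : finite_set S by rewrite finite_setU.
have c0 i : ~ S i -> c i = 0.
  by move=> nS; apply/eqP/negPn/negP => ci; apply: nS; left.
have d0 i : ~ S i -> d i = 0.
  by move=> nS; apply/eqP/negPn/negP => di; apply: nS; right.
apply: (expansion_sum fS) => [i nS|]; first by rewrite c0 // d0 // mulr0 addr0.
rewrite !(@fsum_supp _ _ S) => [|i /d0 ->|i /c0 ->]; rewrite ?scale0r //.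
rewrite !fsbig_finite // scaler_sumr -big_split /=.
by apply: eq_bigr => i _; rewrite scalerDl scalerA.
Qed.

Lemma expansionD x y c d : expansion E x c -> expansion E y d ->
  expansion E (x + y) (fun i => c i + d i).
Proof.
move=> xc yd; have <- : (fun i => 1 * c i + d i) = (fun i => c i + d i).
  by apply/funext => i; rewrite mul1r.
by rewrite -[x]scale1r; exact: expansionP.
Qed.

(** A linear form dual to one vector of a family reads off its coefficient in
    every expansion, so a family with enough such forms has unique expansions,
    whether or not it spans. *)
Lemma expansion_dual (phi : V -> F) j x c : linear (phi : V -> F^o) ->
  (forall i, phi (E i) = (i == j)%:R) -> expansion E x c -> phi x = c j.
Proof.
move=> phil phiE [fc ->].
pose S := [set i | c i != 0] `|` [set j].
have fS : finite_set S by rewrite finite_setU.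
rewrite (@fsum_supp _ _ S) => [|i nS]; last first.
  by have [->|ci] := eqVneq (c i) 0; [rewrite scale0r | case: nS; left].
rewrite (linear_map_fsum _ phil) // (fsbigD1 j) //; last by right.
have phiZ a u : phi (a *: u) = a * phi u.
  have phi0 : phi 0 = 0.
    by have := phil (-1) 0 0; rewrite scaler0 addr0 scaleN1r addNr.
  by rewrite -[a *: u]addr0 phil phi0 addr0.
rewrite phiZ phiE eqxx mulr1 fsbig1 => [|i [_ /eqP /negPf ij]].
  exact: addr0.
by rewrite phiZ phiE ij mulr0.
Qed.

End Expansion.

Section Coordinates.
Variables (F : fieldType) (V : lmodType F) (I : choiceType) (E : I -> V).
Hypothesis E_basis : is_basis E.

Definition coordinates (x : V) : I -> F := projT1 (cid (E_basis x)).

Lemma coordinatesP x : expansion E x (coordinates x).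
Proof. by rewrite /coordinates; case: cid => c []. Qed.

Lemma coordinates_uniq x c : expansion E x c -> coordinates x = c.
Proof. by move=> xc; rewrite /coordinates; case: cid => d /= [_ /(_ c xc)]. Qed.

Lemma coordinates_linear j : linear (coordinates^~ j : V -> F^o).
Proof.
move=> a x y.
by rewrite (coordinates_uniq (expansionP a (coordinatesP x) (coordinatesP y))).
Qed.

Lemma coordinates_basis i j : coordinates (E i) j = (i == j)%:R.
Proof.
rewrite (@coordinates_uniq (E i) (fun j => (i == j)%:R)) //.
apply: (@expansion_sum _ _ _ _ [set i]) => // [k /eqP|].
  by rewrite eq_sym => /negPf ->.
by rewrite fsbig_set1 eqxx scale1r.
Qed.

End Coordinates.

(** * The tensor product of three modules *)

Lemma quot_proj_eq (F : fieldType) (X : choiceType)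
    (G : {freeg X / F} -> Prop) c x y z :
  G (x - c *: y - z) ->
  quot_proj G x = c *: quot_proj G y + quot_proj G z.
Proof.
move=> Gxyz; have -> : c *: quot_proj G y + quot_proj G z =
    quot_proj G (c *: y + z) by rewrite quot_projD quot_projZ.
apply/quot_projP; rewrite -[_ - _]scale1r -[_ *: _]addr0 opprD addrA.
by apply: spanDZ => //; exact: span0.
Qed.

Section Tensor.
Variables (F : fieldType) (U V W : lmodType F).

Lemma tens_linear1 v w : linear (fun u : U => tens u v w : tensor3 U V W).
Proof. by move=> c u u'; apply: quot_proj_eq; exact: Multilin1. Qed.

Lemma tens_linear2 u w : linear (fun v : V => tens u v w : tensor3 U V W).
Proof. by move=> c v v'; apply: quot_proj_eq; exact: Multilin2. Qed.

Lemma tens_linear3 u v : linear (fun w : W => tens u v w : tensor3 U V W).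
Proof. by move=> c w w'; apply: quot_proj_eq; exact: Multilin3. Qed.

Section TrilinearLift.
Variables (X : lmodType F) (phi : U -> V -> W -> X).
Hypothesis phi1 : forall v w, linear (fun u => phi u v w).
Hypothesis phi2 : forall u w, linear (fun v => phi u v w).
Hypothesis phi3 : forall u v, linear (phi u v).

Let phi_gen (y : U * V * W) := phi y.1.1 y.1.2 y.2.

Lemma multilinear_lift D : multilinear D -> fglift phi_gen D = 0.
Proof.
by case=> *; rewrite !linearB linearZ /= !fglift_gen /phi_gen /=
  ?phi1 ?phi2 ?phi3 addrAC addrK subrr.
Qed.

Lemma tens_lift_linear : linear (lift_gen phi_gen : tensor3 U V W -> X).
Proof. exact: lift_gen_linear multilinear_lift. Qed.

Lemma tens_liftE u v w :
  lift_gen phi_gen (tens u v w : tensor3 U V W) = phi u v w.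
Proof. by rewrite lift_gen_proj ?fglift_gen //; exact: multilinear_lift. Qed.

End TrilinearLift.

(** The map on the tensor product is defined on representatives; it acts factor
    by factor because a trilinear map factors through the quotient. *)
Lemma tens_mapE (f : U -> U) (g : V -> V) (h : W -> W) u v w :
  linear f -> linear g -> linear h ->
  tens_map f g h (tens u v w) = tens (f u) (g v) (h w).
Proof.
move=> fl gl hl.
apply: (tens_liftE (phi := fun u v w => tens (f u) (g v) (h w))).
- by move=> v' w' c x y; rewrite fl tens_linear1.
- by move=> u' w' c x y; rewrite gl tens_linear2.
- by move=> u' v' c x y; rewrite hl tens_linear3.
Qed.

(** The product of three coordinate functionals is trilinear, hence defines a
    linear form on the tensor product, and these forms are dual to the tensors
    of basis vectors. *)
Lemma tens_expansion_uniq (I J K : choiceType) (E : I -> U) (E' : J -> V)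
    (E'' : K -> W) (x : tensor3 U V W) (c d : I * J * K -> F) :
  is_basis E -> is_basis E' -> is_basis E'' ->
  let EEE i : tensor3 U V W := tens (E i.1.1) (E' i.1.2) (E'' i.2) in
  expansion EEE x c -> expansion EEE x d -> c = d.
Proof.
move=> bE bE' bE'' EEE xc xd; apply/funext => -[[i j] k].
pose phi u v w : F^o :=
  coordinates bE u i * coordinates bE' v j * coordinates bE'' w k.
have phi1 v w : linear (fun u => phi u v w).
  move=> a u u'; rewrite /phi coordinates_linear !mulrDl.
  by rewrite -!mulrA -[LHS]/(a * _ + _).
have phi2 u w : linear (fun v => phi u v w).
  move=> a v v'; rewrite /phi coordinates_linear mulrDr mulrDl.
  by rewrite -[a *: _]/(a * _) -[a *: _]/(a * _); congr (_ + _); ring.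
have phi3 u v : linear (phi u v).
  move=> a w w'; rewrite /phi coordinates_linear mulrDr.
  by rewrite -[a *: _]/(a * _) -[a *: _]/(a * _); congr (_ + _); ring.
have dual i0 : lift_gen (fun y => phi y.1.1 y.1.2 y.2) (EEE i0) =
    (i0 == (i, j, k))%:R.
  rewrite tens_liftE // /phi !coordinates_basis -!natrM !mulnb.
  by case: i0 => -[].
by rewrite -(expansion_dual (tens_lift_linear phi1 phi2 phi3) dual xc)
           -(expansion_dual (tens_lift_linear phi1 phi2 phi3) dual xd).
Qed.

End Tensor.

(** * Partitions *)

Section Partitions.
Implicit Types l m : intpart.

Lemma sumn_incr_nth (v : seq nat) i : sumn (incr_nth v i) = (sumn v).+1.
Proof.
elim: v i => [|x v IH] [|i] //=; last by rewrite IH addnS.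
by elim: i.
Qed.

Lemma nth_leq_sumn (v : seq nat) i : (nth 0%N v i <= sumn v)%N.
Proof.
elim: v i => [|x v IH] [|i] //=; first exact: leq_addr.
exact: leq_trans (IH i) (leq_addl _ _).
Qed.

Lemma size_leq_sumn (v : seq nat) : 0%N \notin v -> (size v <= sumn v)%N.
Proof.
elim: v => //= x v IH; rewrite inE negb_or eq_sym -lt0n => /andP[x0 /IH].
by rewrite -add1n; apply: leq_add.
Qed.

Lemma part_nth_gt0 l i : (0 < nth 0 (val l) i)%N = (i < size (val l))%N.
Proof.
have [il|il] := ltnP i; last by rewrite nth_default.
case: l il => l /= /andP[_ l0] il; rewrite lt0n; apply: contraNneq l0 => <-.
exact: mem_nth.
Qed.

Lemma part_inj_nth l m : nth 0%N (val l) =1 nth 0%N (val m) -> l = m.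
Proof.
move=> lm.
have h i : (i < size (val l))%N = (i < size (val m))%N.
  by rewrite -!part_nth_gt0 lm.
have sz : size (val l) = size (val m).
  by apply/anti_leq; rewrite leqNgt h ltnn /= leqNgt -h ltnn.
exact/val_inj/(@eq_from_nth _ 0%N).
Qed.

(** The sum bounds the number of parts and each of them, so these partitions
    embed in the functions from a finite interval to itself. *)
Lemma finite_part_sumn n : finite_set [set l : intpart | sumn (val l) = n].
Proof.
(* The default value [None] confines injectivity to partitions of size [n]. *)
pose f l : option {ffun 'I_n.+1 -> 'I_n.+1} :=
  if sumn (val l) == n then
    Some [ffun i : 'I_n.+1 => inord (nth 0%N (val l) i)] else None.
rewrite (_ : [set _ | _] = f @^-1` [set y | y != None]); last first.
  apply/seteqP; split=> l; rewrite /preimage /= /f.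
    by move=> /eqP ->.
  by case: ifP => // /eqP.
apply: finite_preimage => [l m|]; last exact: finite_finset.
rewrite !inE /= /f; case: ifP => // /eqP ln _; case: ifP => // /eqP mn _ [] lm.
apply: part_inj_nth => i.
have bnd (k : intpart) : sumn (val k) = n -> (size (val k) <= n)%N.
  by case: k => k /= /andP[_ k0] <-; exact: size_leq_sumn.
have [i_n|n_i] := ltnP i n.+1; last first.
  have bl := leq_trans (bnd _ ln) (ltnW n_i).
  have bm := leq_trans (bnd _ mn) (ltnW n_i).
  by rewrite !nth_default.
have := congr1 (fun g : {ffun _ -> _} => val (g (Ordinal i_n))) lm.
rewrite !ffunE /= !inordK // ltnS.
  by rewrite -mn nth_leq_sumn.
by rewrite -ln nth_leq_sumn.
Qed.

Lemma finite_add_box l : finite_set (add_box l).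
Proof.
apply: sub_finite_set (finite_part_sumn (sumn (val l)).+1) => m /= [i ->].
exact: sumn_incr_nth.
Qed.

Lemma finite_rem_box l : finite_set (rem_box l).
Proof.
apply: sub_finite_set (finite_part_sumn (sumn (val l)).-1) => m /= [i ->].
by rewrite sumn_incr_nth.
Qed.

(** The box (i, j) belongs to the diagram if and only if (j, i) belongs to the
    transposed one, whose rows are these counts. *)
Lemma sorted_count_gt (v : seq nat) i j : sorted geq v ->
  (i < count (ltn j) v)%N = (j < nth 0 v i)%N.
Proof.
elim: v i => [|x v IH] i /=; first by rewrite nth_nil.
move=> xv; have v_sorted := path_sorted xv.
have [jx|xj] := ltnP j x; first by case: i => [|i] //=; rewrite ltnS IH.
have vx : {in v, forall y, (y <= x)%N}.
  apply/allP; apply: (@order_path_min _ geq) xv.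
  by move=> a b c /= ba ac; exact: leq_trans ac ba.
rewrite add0n (_ : count _ _ = 0%N); last first.
  apply/eqP; rewrite -leqn0 leqNgt -has_count -all_predC; apply/allP => y /vx.
  by move=> yx /=; rewrite -leqNgt (leq_trans yx).
case: i => [|i] /=; first by rewrite [RHS]ltnNge xj.
have [iv|iv] := ltnP i (size v); last by rewrite nth_default.
by rewrite [RHS]ltnNge (leq_trans (vx _ (mem_nth _ iv))).
Qed.

Lemma part_nth_head l i : (nth 0 (val l) i <= head 0 (val l))%N.
Proof.
case: l => l /= /andP[ls _]; rewrite -nth0 leqNgt -sorted_count_gt // -leqNgt.
rewrite leqNgt; apply/negP => h.
have : (0 < count (ltn (nth 0%N l 0)) l)%N by exact: leq_ltn_trans h.
by rewrite sorted_count_gt // ltnn.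
Qed.

Lemma nth_conj_part l j :
  nth 0%N (val (conj_part l)) j = count (ltn j) (val l).
Proof.
rewrite /= /conj_seq; have [jl|jl] := ltnP j (head 0%N (val l)).
  by rewrite (nth_map 0%N) ?size_iota // nth_iota.
rewrite nth_default ?size_map ?size_iota //.
apply/esym/eqP; rewrite -leqn0 leqNgt sorted_count_gt; last first.
  by case: (l) => v /= /andP[].
by rewrite nth0 -leqNgt.
Qed.

(** Transposition changes the sign of the content of each box. *)
Lemma content_gen_conj (F : fieldType) l (q : F) :
  content_gen (conj_part l) q = content_gen l q^-1.
Proof.
rewrite /content_gen.
have sz : size (val (conj_part l)) = head 0%N (val l).
  by rewrite /= size_map size_iota.
rewrite sz.
(* Both sides become sums over a rectangle containing the diagram. *)
under eq_bigr => j _ do rewrite nth_conj_part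
  (big_ord_widen _ (fun i => q ^ (i%:Z - j%:Z)) (count_size _ _)).
under [RHS]eq_bigr => i _ do rewrite
  (big_ord_widen _ (fun j => q^-1 ^ (j%:Z - i%:Z)) (part_nth_head _ _)).
rewrite (exchange_big_dep xpredT) //=; apply: eq_bigr => i _.
apply: eq_big => [j|j _]; last by rewrite exprz_inv opprB.
by rewrite sorted_count_gt //; case: (l) => v /= /andP[].
Qed.

End Partitions.

(** * Sparse operators on formal sums *)

Section Collect.
Variables (F : fieldType) (V : lmodType F) (J : choiceType).
Variables (E : J -> V) (t : J -> F).

(** Expresses that [w] is the family of coefficients, along [E], of the formal
    sum of the [t j *: v j]. The matrix of the [v j] is asked to have
    finite columns as well as finite rows, so that no convergence question
    arises. A column combination is itself an expansion, of a scalar along the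
    family [t], which lets rows and columns be handled by the same lemmas. *)
Definition collects (v : J -> V) (w : J -> F) : Prop :=
  exists M : J -> J -> F,
    (forall j, expansion E (v j) (M j)) /\
    (forall i, expansion (t : J -> F^o) (w i) (M^~ i)).

Lemma eq_collects v v' w w' : v =1 v' -> w =1 w' ->
  collects v w -> collects v' w'.
Proof. by move=> /funext -> /funext ->. Qed.

Lemma collectsD v v' w w' : collects v w -> collects v' w' ->
  collects (v \+ v') (w \+ w').
Proof.
move=> [M [vM wM]] [M' [vM' wM']]; exists (fun j i => M j i + M' j i).
by split=> [j|i]; exact: expansionD.
Qed.

(** Transposition of a sparse matrix: an operator sending [j] to its successors
    for a relation [S] collects at [i] the contributions of its predecessors. *)
Lemma collects_hop (S : J -> set J) (k : J -> J -> F) :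
  (forall j, finite_set (S j)) -> (forall i, finite_set [set j | S j i]) ->
  collects (fun j => \sum_(i \in S j) k j i *: E i)
           (fun i => \sum_(j \in [set j | S j i]) k j i * t j).
Proof.
move=> fS fS'; exists (fun j => patch (fun=> 0) (S j) (k j)); split=> [j|i].
  exact: expansion_patch.
have -> : (fun j => patch (fun=> 0) (S j) (k j) i) =
    patch (fun=> 0) [set j | S j i] (k^~ i).
  apply/funext => j; rewrite /patch.
  have -> // : (j \in [set j | S j i]) = (i \in S j).
  by apply/idP/idP; rewrite !inE.
exact: (@expansion_patch _ F^o).
Qed.

Lemma collects_diag (d : J -> F) :
  collects (fun j => d j *: E j) (fun j => d j * t j).
Proof.
have S' i : [set j : J | [set j] i] = [set i] by apply/seteqP; split=> j /= ->.
apply: eq_collects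
    (@collects_hop (fun j => [set j]) (fun j _ => d j) _ _) => //.
- by move=> j; rewrite fsbig_set1.
- by move=> i; rewrite S' fsbig_set1.
- by move=> i; rewrite S'.
Qed.

(** The laws of a lens, which make [J] behave like a product having
    [intpart] as one of its factors. *)
Record slot (get : J -> intpart) (put : J -> intpart -> J) : Prop := {
  get_put : forall l m, get (put l m) = m;
  put_put : forall l m n, put (put l m) n = put l n;
  put_get : forall l, put l (get l) = l }.

(** An operator that moves one partition along a graph [B] collects
    coefficients along the reversed graph. For boxes being added these are the
    partitions with a box removed, and conversely. *)
Lemma collects_slot get put (B : intpart -> set intpart)
    (k : intpart -> intpart -> F) : slot get put ->
  (forall l, finite_set (B l)) -> (forall m, finite_set [set l | B l m]) ->
  collects (fun l => \sum_(m \in B (get l)) k (get l) m *: E (put l m))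
    (fun l => \sum_(m \in [set m | B m (get l)]) k m (get l) * t (put l m)).
Proof.
move=> [gp pp pg] fB fB'.
have put_inj l (A : set intpart) : set_inj A (put l).
  by move=> m n _ _ /(congr1 get); rewrite !gp.
pose S l := put l @` B (get l).
have S' i : [set l | S l i] = put i @` [set m | B m (get i)].
  apply/seteqP; split=> l /=.
    by move=> [m Bm <-]; exists (get l); rewrite ?gp // pp pg.
  by move=> [m Bm <-]; exists (get i); rewrite ?gp // pp pg.
apply: eq_collects
    (@collects_hop S (fun j i => k (get j) (get i)) _ _) => [l|l|l|l].
- by rewrite fsbig_image //; apply: eq_fsbigr => m _; rewrite gp.
- by rewrite S' fsbig_image //; apply: eq_fsbigr => m _; rewrite gp.
- exact: finite_image.
- by rewrite S'; apply: finite_image.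
Qed.

(** Since expansions are unique, the matrix whose existence
    [formal_sum_eq0] asserts has to be the known one; it vanishes outside the
    range of [emb], where the equations are therefore trivial. *)
Lemma formal_sum_eq0P (I : choiceType) (EE : I -> V) (emb : J -> I) v w :
  (forall x c d, expansion EE x c -> expansion EE x d -> c = d) ->
  injective emb -> E =1 EE \o emb -> collects v w ->
  formal_sum_eq0 EE t v <-> (forall i, w i = 0).
Proof.
move=> EE_uniq emb_inj EEE [M [vM wM]].
(* [N] extends [M] by zero along [emb]. *)
pose N j i := if pselect (exists j', emb j' = i) is left h
              then M j (projT1 (cid h)) else 0.
have NE j i : N j (emb i) = M j i.
  rewrite /N; case: pselect => [h|[]]; last by exists i.
  by case: cid => i' /= /emb_inj ->.
have N0 j i : ~ (exists j', emb j' = i) -> N j i = 0.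
  by rewrite /N; case: pselect.
have vN j : expansion EE (v j) (N j).
  have [fM ->] := vM j.
  apply: (@expansion_sum _ _ _ _ (emb @` [set i | M j i != 0])).
  - exact: finite_image.
  - move=> i nS; have [[j' ij']|/N0 //] := pselect (exists j', emb j' = i).
    rewrite -ij' NE; apply/eqP/negPn/negP => Mj; apply: nS.
    by exists j'.
  - rewrite (@fsum_supp _ _ [set i | M j i != 0]) => [|i /negP]; last first.
      by rewrite negbK => /eqP ->; rewrite scale0r.
    rewrite fsbig_image => [|i i' _ _ /emb_inj //].
    by apply: eq_fsbigr => i _; rewrite NE EEE.
have sumN i : \sum_(j \in [set: J]) t j * N j (emb i) = w i.
  have [_ ->] := wM i; apply: eq_fsbigr => j _.
  by rewrite NE mulrC.
split=> [[M' [vM' sumM']] i|w0].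
  have [_ <-] := sumM' (emb i); rewrite -sumN.
  by apply: eq_fsbigr => j _; rewrite (EE_uniq _ _ _ (vN j) (vM' j)).
exists N; split=> // i.
have [[j' <-]|ni] := pselect (exists j', emb j' = i).
  split; last by rewrite sumN.
  have [fM _] := wM j'; apply: sub_finite_set fM => j /=.
  by rewrite NE; apply: contra_neq => ->; rewrite mulr0.
split; last by rewrite fsbig1 // => j _; rewrite N0 // mulr0.
rewrite (_ : [set j | _] = set0) // -subset0 => j /=.
by rewrite N0 // mulr0 eqxx.
Qed.

End Collect.

(** * The coefficient field *)

Section Coefficients.
Variable K : fieldType.

Lemma coef_is_zmod_morphism : zmod_morphism (@coef K).
Proof. by move=> x y; rewrite /coef !raddfB. Qed.

Lemma coef_is_monoid_morphism : monoid_morphism (@coef K).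
Proof.
split=> [|x y]; first by rewrite /coef mpoly.mpolyC1 rmorph1.
by rewrite /coef mpoly.mpolyCM rmorphM.
Qed.

HB.instance Definition _ := GRing.isZmodMorphism.Build K (coef_field K)
  (@coef K) coef_is_zmod_morphism.
HB.instance Definition _ := GRing.isMonoidMorphism.Build K (coef_field K)
  (@coef K) coef_is_monoid_morphism.

Lemma mpolyX_neq0 n (m : mpoly.multinom n) : mpoly.mpolyX K m != 0.
Proof.
apply: contra_neq (oner_neq0 K) => Xm0.
by have := mpoly.mcoeffX K m m; rewrite Xm0 mpoly.mcoeff0 eqxx.
Qed.

Lemma framing_var_neq0 k : framing_var K k != 0.
Proof. by rewrite /framing_var tofrac_eq0 mpolyX_neq0. Qed.

(** A framing variable is transcendental over the constants: setting all the
    variables to zero gives [x = 0], and then [y = 0] by cancellation. *)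
Lemma coef_framing_eq0 k (x y : K) :
  coef x + framing_var K k ^+ 2 * coef y = 0 <-> x = 0 /\ y = 0.
Proof.
split=> [|[-> ->]]; last by rewrite !rmorph0 mulr0 addr0.
rewrite /framing_var /coef -rmorphXn -rmorphM -rmorphD => /eqP.
rewrite tofrac_eq0 => /eqP xy0.
have x0 : x = 0.
  have := congr1 (mpoly.mcoeff mpoly.mnm0) xy0.
  rewrite rmorphD rmorphM rmorphXn /= mpoly.mpolyCK mpoly.mcoeffX.
  by rewrite mpoly.mnm1_eq0 expr0n mul0r addr0 raddf0.
split=> //; move/eqP: xy0; rewrite x0 raddf0 add0r mulf_eq0 expf_eq0 /=.
by rewrite (negPf (mpolyX_neq0 _)) mpoly.mpolyC_eq0 => /eqP.
Qed.

End Coefficients.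

Section Morphism.
Variables (K F : fieldType) (phi : {rmorphism K -> F}).

Lemma rmorph_content_gen l (q : K) :
  phi (content_gen l q) = content_gen l (phi q).
Proof.
rewrite /content_gen rmorph_sum; apply: eq_bigr => i _.
by rewrite rmorph_sum; apply: eq_bigr => j _; exact: fmorphXz.
Qed.

Lemma rmorph_schur_box l (s : K) : phi (schur_box s l) = schur_box (phi s) l.
Proof.
rewrite /schur_box rmorphD rmorphM fmorphV rmorphB fmorphV.
by rewrite rmorph_content_gen rmorphXn.
Qed.

Lemma rmorph_fsum (I : choiceType) (A : set I) (f : I -> K) : finite_set A ->
  phi (\sum_(i \in A) f i) = \sum_(i \in A) phi (f i).
Proof. by move=> fA; rewrite !fsbig_finite // rmorph_sum. Qed.

End Morphism.

(** * The operators of one solid torus *)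

Section Legs.
Variables (F : fieldType) (V : lmodType F) (J : choiceType) (E : J -> V).
Variables (s z a : F).

(** What is used about a solid torus: the Morton-Samuelson formulas for the
    action on one partition of the index. In [leg_N1] the vector [X] stands for
    the contribution of W_(l, bar box), the same in both formulas. *)
Record leg (get : J -> intpart) (put : J -> intpart -> J)
    (P : int -> int -> V -> V) : Prop := {
  leg_slot : slot get put;
  leg_00 : forall l, P 0 0 (E l) = ((a - a^-1) / z) *: E l;
  leg_10 : forall l, P 1 0 (E l) =
    ((a - a^-1) / z + a * z * content_gen (get l) (s ^+ 2)) *: E l;
  leg_N10 : forall l, P (-1) 0 (E l) =
    ((a - a^-1) / z - a^-1 * z * content_gen (get l) (s ^- 2)) *: E l;
  leg_01 : forall l, P 0 1 (E l) = \sum_(m \in add_box (get l)) E (put l m);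
  leg_N11 : forall l, P (-1) 1 (E l) =
    \sum_(m \in add_box (get l))
      (a^-1 * s ^ (kappa (get l) - kappa m)) *: E (put l m);
  leg_N1 : forall l, exists X,
    P 0 (-1) (E l) = \sum_(m \in rem_box (get l)) E (put l m) + X /\
    P 1 (-1) (E l) = a *: (\sum_(m \in rem_box (get l))
      s ^ (kappa (get l) - kappa m) *: E (put l m)) + a^-1 *: X }.

(** Inserting a vector in one tensor factor, the others being fixed, is linear,
    so that it transports the formulas from the skein module of a solid torus
    to the tensor product. *)
Lemma leg_of_skein (R : realType)
    (act : skein R z a thick_torus -> skein R z a solid_torus ->
           skein R z a solid_torus)
    (W : intpart -> intpart -> skein R z a solid_torus)
    (inj : J -> skein R z a solid_torus -> V) get put P :
  skein_basis s act W -> slot get put ->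
  (forall l, linear (inj l)) ->
  (forall l m, inj l (W m empty_part) = E (put l m)) ->
  (forall i j l, P i j (E l) =
     inj l (act (Pcurve R z a i j) (W (get l) empty_part))) ->
  leg get put P.
Proof.
move=> B gp injl injW PE.
have injZ l c x : inj l (c *: x) = c *: inj l x by exact: scalable_linear.
have injD l x y : inj l (x + y) = inj l x + inj l y.
  by have := injl l 1 x y; rewrite !scale1r.
have injE l : inj l (W (get l) empty_part) = E l by rewrite injW (put_get gp).
have injS l (A : set intpart) (k : intpart -> F) : finite_set A ->
    inj l (\sum_(m \in A) k m *: W m empty_part) =
    \sum_(m \in A) k m *: E (put l m).
  move=> fA; rewrite linear_map_fsum //.
  by apply: eq_fsbigr => m _; rewrite injZ injW.
have injS1 l (A : set intpart) : finite_set A ->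
    inj l (\sum_(m \in A) W m empty_part) = \sum_(m \in A) E (put l m).
  move=> fA; rewrite linear_map_fsum //.
  by apply: eq_fsbigr => m _; rewrite injW.
split=> // l; rewrite ?PE.
- by rewrite (sb_00 B) injZ injE.
- by rewrite (sb_10 B) injZ injE.
- by rewrite (sb_N10 B) injZ injE.
- by rewrite (sb_01 B) injS1 //; exact: finite_add_box.
- by rewrite (sb_N11 B) injS //; exact: finite_add_box.
exists (inj l (W (get l) box_part)); rewrite (sb_0N1 B) (sb_1N1 B).
have fr := finite_rem_box (get l).
by split; rewrite !(injD, injZ) ?injS1 ?injS.
Qed.

Hypotheses (a_neq0 : a != 0) (z_neq0 : z != 0).

Section Combinations.
Variables (get : J -> intpart) (put : J -> intpart -> J).
Variables (P : int -> int -> V -> V) (P_leg : leg get put P).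

(** The unknot is there to cancel the part of the meridian eigenvalue that does
    not depend on the partition, and the prefactor to remove [a]. The same holds
    in [leg_twisted_growth]. *)
Lemma leg_growth c l :
  a^-1 *: (P 0 0 (E l) - P 1 0 (E l) - (a * c) *: P 0 1 (E l)) =
  - (z * content_gen (get l) (s ^+ 2)) *: E l +
  \sum_(m \in add_box (get l)) (- c) *: E (put l m).
Proof.
have fA := finite_add_box (get l).
rewrite (leg_00 P_leg) (leg_10 P_leg) (leg_01 P_leg).
rewrite -scalerBl scalerBr !scalerA mulKf // -scaleNr; congr (_ *: _ + _).
  by rewrite opprD addrA subrr sub0r mulrN -mulrA mulKf.
by rewrite !fsbig_finite // scaler_sumr.
Qed.

Lemma leg_twisted_growth c l : c != 0 ->
  (a * c) *: (P 0 0 (E l) + c^-1 *: P (-1) 1 (E l) - P (-1) 0 (E l)) =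
  (c * z * content_gen (get l) (s ^- 2)) *: E l +
  \sum_(m \in add_box (get l)) s ^ (kappa (get l) - kappa m) *: E (put l m).
Proof.
move=> c_neq0; have fA := finite_add_box (get l).
rewrite (leg_00 P_leg) (leg_N10 P_leg) (leg_N11 P_leg).
rewrite addrAC -scalerBl scalerDr !scalerA; congr (_ *: _ + _).
  by field; rewrite a_neq0 z_neq0.
rewrite scaler_fsumr //; apply: eq_fsbigr => m _.
by rewrite mulfK // mulVKf.
Qed.

(** The coefficients are such that the two contributions of the vector [X] of
    [leg_N1] cancel, since [a * a^-1 = 1]. *)
Lemma leg_decay l :
  a *: P 0 0 (E l) - P 0 (-1) (E l) + a *: P 1 (-1) (E l) =
  ((a ^+ 2 - 1) / z) *: E l +
  \sum_(m \in rem_box (get l))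
    (a ^+ 2 * s ^ (kappa (get l) - kappa m)) *: E (put l m) +
  \sum_(m \in rem_box (get l)) (- 1) *: E (put l m).
Proof.
have fA := finite_rem_box (get l).
have [X [PX PX']] := leg_N1 P_leg l; rewrite (leg_00 P_leg) PX PX'.
rewrite scalerDr !scalerA divff // scale1r -expr2 scaler_fsumr //.
have -> : a * ((a - a^-1) / z) = (a ^+ 2 - 1) / z.
  by rewrite mulrA mulrBr divff // expr2.
rewrite [in RHS](_ : \sum_(m \in _) (-1) *: _ =
  - \sum_(m \in rem_box (get l)) E (put l m)); last first.
  rewrite !fsbig_finite // -sumrN.
  by apply: eq_bigr => m _; rewrite scaleN1r.
by rewrite opprD -!addrA; congr (_ + _); rewrite [_ + X]addrC addKr addrC.
Qed.

End Combinations.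
End Legs.

(** * The operator of the vertex *)

Section VertexOperator.
Variables (K F : fieldType) (phi : {rmorphism K -> F}) (s : K) (b : F).
Let z := phi s - (phi s)^-1.
Variables (a1 a2 : F) (V : lmodType F) (J : choiceType) (E : J -> V).
Variables (get1 get2 get3 : J -> intpart) (put1 put2 put3 : J -> intpart -> J).
Variables (P1 P2 P3 : int -> int -> V -> V) (tau : J -> K).

Hypotheses (z_neq0 : s - s^-1 != 0) (a1_neq0 : a1 != 0) (a2_neq0 : a2 != 0)
  (b_neq0 : b != 0).
Hypothesis leg1 : leg E (phi s) z a1 get1 put1 P1.
Hypothesis leg2 : leg E (phi s) z a2 get2 put2 P2.
Hypothesis leg3 : leg E (phi s) z b get3 put3 P3.

(** The common shape of the three operators: leg 1 grows, leg 2 grows with a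
    twist and leg 3 decays. Only the framing variable [b] of leg 3 survives in
    the matrix of its action. *)
Definition vertex_operator (v : V) : V :=
  a1^-1 *: (P1 0 0 v - P1 1 0 v - (a1 * b ^+ 2) *: P1 0 1 v)
  + (a2 * b ^+ 2) *: (P2 0 0 v + b ^- 2 *: P2 (-1) 1 v - P2 (-1) 0 v)
  + (b *: P3 0 0 v - P3 0 (-1) v + b *: P3 1 (-1) v).

(** The failure of each of the two recursions; in the coefficients of the
    formal sum the first one is multiplied by [b ^+ 2]. *)
Definition framed_defect l : K :=
  schur_box s (conj_part (get2 l)) * tau l -
  (\sum_(m \in rem_box (get1 l)) tau (put1 l m) -
   \sum_(m \in add_box (get3 l))
      s ^ (kappa m - kappa (get3 l)) * tau (put3 l m)).

Definition unframed_defect l : K :=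
  schur_box s (get1 l) * tau l -
  (\sum_(m \in rem_box (get2 l))
      s ^ (kappa m - kappa (get2 l)) * tau (put2 l m) -
   \sum_(m \in add_box (get3 l)) tau (put3 l m)).

(** Growth of a leg turns into removal of boxes in the coefficients and decay
    into addition. The diagonal terms [z * C] and [1 / z], sorted by powers of
    [b], give the two functions [schur_box], up to the sign in [b ^+ 0]. *)
Lemma collects_vertex_operator :
  collects E (fun l => phi (tau l)) (fun l => vertex_operator (E l))
    (fun l => phi (- unframed_defect l) + b ^+ 2 * phi (framed_defect l)).
Proof.
have zc_neq0 : z != 0 by rewrite /z -fmorphV -rmorphB fmorph_eq0.
have sl1 := leg_slot leg1; have sl2 := leg_slot leg2; have sl3 := leg_slot leg3.
pose fA := finite_add_box; pose fR := finite_rem_box.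
pose q := phi s ^+ 2.
pose t l := phi (tau l).
pose d l := - (z * content_gen (get1 l) q) +
  (b ^+ 2 * z * content_gen (get2 l) q^-1) + (b ^+ 2 - 1) / z.
(* One diagonal term and four hops: the decay of leg 3 contributes to both
   powers of [b]. *)
pose T1 := collects_diag E t d.
pose T2 := collects_slot E t (fun _ _ => - b ^+ 2) sl1 fA fR.
pose T3 := collects_slot E t (fun l m => phi s ^ (kappa l - kappa m)) sl2 fA fR.
pose T4 := collects_slot E t
  (fun l m => b ^+ 2 * phi s ^ (kappa l - kappa m)) sl3 fR fA.
pose T5 := collects_slot E t (fun _ _ => - 1) sl3 fR fA.
apply: (eq_collects _ _
  (collectsD T1 (collectsD T2 (collectsD T3 (collectsD T4 T5))))) => l /=.
  rewrite /vertex_operator (leg_growth a1_neq0 leg1).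
  rewrite (leg_twisted_growth a2_neq0 zc_neq0 leg2) ?expf_neq0 //.
  rewrite (leg_decay b_neq0 leg3) /d !scalerDl -/q.
  have regroup (x1 x2 x3 x4 x5 x6 x7 : V) :
      x1 + x2 + x3 + (x4 + (x5 + (x6 + x7))) =
      x1 + x4 + (x2 + x5) + (x3 + x6 + x7).
    by rewrite (addrACA x1) -!addrA !(addrCA x3).
  exact: regroup.
rewrite /framed_defect /unframed_defect.
rewrite !(rmorphN, rmorphB, rmorphM) /= !rmorph_schur_box !rmorph_fsum //.
have schurE l' : schur_box (phi s) l' = z * content_gen l' q + z^-1 by [].
rewrite !schurE content_gen_conj.
have phiM (A : set intpart) (n : intpart -> int) (f : intpart -> K) :
    \sum_(m \in A) phi (s ^ n m * f m) = \sum_(m \in A) phi s ^ n m * phi (f m).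
  by apply: eq_fsbigr => m _; rewrite rmorphM fmorphXz.
pose S1 := \sum_(m \in rem_box (get1 l)) t (put1 l m).
pose S2 := \sum_(m \in rem_box (get2 l))
  phi s ^ (kappa m - kappa (get2 l)) * t (put2 l m).
pose S3 := \sum_(m \in add_box (get3 l)) t (put3 l m).
pose S3' := \sum_(m \in add_box (get3 l))
  phi s ^ (kappa m - kappa (get3 l)) * t (put3 l m).
have e1 : \sum_(m \in rem_box (get1 l)) - b ^+ 2 * t (put1 l m) = - b ^+ 2 * S1.
  by rewrite mulr_fsumr.
have e3 : \sum_(m \in add_box (get3 l)) - 1 * t (put3 l m) = - 1 * S3.
  by rewrite mulr_fsumr.
have e3' : \sum_(m \in add_box (get3 l))
    b ^+ 2 * phi s ^ (kappa m - kappa (get3 l)) * t (put3 l m) = b ^+ 2 * S3'.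
  by rewrite mulr_fsumr; apply: eq_fsbigr => m _; rewrite mulrA.
rewrite [X in _ + (X + _)]e1 [X in _ + (_ + (_ + (X + _)))]e3'.
rewrite [X in _ + (_ + (_ + (_ + X)))]e3 [X in _ - (X - _)]phiM.
rewrite [X in _ * (_ - (_ - X))]phiM.
have combine (C1 C2 T' : F) (A1 A2 A3 A3' : F) :
    (- (z * C1) + b ^+ 2 * z * C2 + (b ^+ 2 - 1) / z) * T' +
      (- b ^+ 2 * A1 + (A2 + (b ^+ 2 * A3' + - 1 * A3))) =
    - ((z * C1 + z^-1) * T' - (A2 - A3)) +
      b ^+ 2 * ((z * C2 + z^-1) * T' - (A1 - A3')).
  by ring.
exact: (combine _ _ _ S1 S2 S3 S3').
Qed.

End VertexOperator.

(** * The three tensor factors *)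

Section Vertex.
Variables (R : realType) (K : fieldType) (s : K).
Hypotheses (z_neq0 : s - s^-1 != 0).
Let z := coef s - (coef s)^-1.
Variable act : forall k : 'I_3, leg_skein R s thick_torus k ->
  leg_skein R s solid_torus k -> leg_skein R s solid_torus k.
Hypothesis act_insertion : forall k, insertion_action (@act k).
Variable W : forall k : 'I_3, intpart -> intpart -> leg_skein R s solid_torus k.
Hypothesis W_basis : forall k, skein_basis (coef s) (@act k) (W k).

Notation triple := (intpart * intpart * intpart)%type.

Definition get0 (l : triple) := l.1.1.
Definition get1 (l : triple) := l.1.2.
Definition get2 (l : triple) := l.2.
Definition put0 (l : triple) m : triple := (m, l.1.2, l.2).
Definition put1 (l : triple) m : triple := (l.1.1, m, l.2).
Definition put2 (l : triple) m : triple := (l.1.1, l.1.2, m).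

Lemma slot0 : slot get0 put0. Proof. by split=> // -[[]]. Qed.
Lemma slot1 : slot get1 put1. Proof. by split=> // -[[]]. Qed.
Lemma slot2 : slot get2 put2. Proof. by split=> // -[[]]. Qed.

Lemma Pact_linear k i j : linear (@Pact R K s act k i j).
Proof. by move=> c x y; rewrite /Pact (act_linear_r (act_insertion k)). Qed.

Lemma id_linear (U : lmodType (coef_field K)) : linear (id : U -> U).
Proof. by []. Qed.

Lemma leg0 : leg (Wvertex W) (coef s) z (framing_var K 0) get0 put0 (P1 act).
Proof.
pose inj (l : triple) x : vertex_skein R s :=
  tens x (W 1 l.1.2 empty_part) (W 2 l.2 empty_part).
apply: (leg_of_skein (inj := inj) (W_basis 0) slot0) => // [l|i j l].
  exact: tens_linear1.
rewrite /P1 /Wvertex /Wtens /=.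
by apply: tens_mapE; first [exact: Pact_linear | exact: id_linear].
Qed.

Lemma leg1 : leg (Wvertex W) (coef s) z (framing_var K 1) get1 put1 (P2 act).
Proof.
pose inj (l : triple) x : vertex_skein R s :=
  tens (W 0 l.1.1 empty_part) x (W 2 l.2 empty_part).
apply: (leg_of_skein (inj := inj) (W_basis 1) slot1) => // [l|i j l].
  exact: tens_linear2.
rewrite /P2 /Wvertex /Wtens /=.
by apply: tens_mapE; first [exact: Pact_linear | exact: id_linear].
Qed.

Lemma leg2 : leg (Wvertex W) (coef s) z (framing_var K 2) get2 put2 (P3 act).
Proof.
pose inj (l : triple) x : vertex_skein R s :=
  tens (W 0 l.1.1 empty_part) (W 1 l.1.2 empty_part) x.
apply: (leg_of_skein (inj := inj) (W_basis 2) slot2) => // [l|i j l].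
  exact: tens_linear3.
rewrite /P3 /Wvertex /Wtens /=.
by apply: tens_mapE; first [exact: Pact_linear | exact: id_linear].
Qed.

(** Uniqueness of expansions reduces the vanishing of the formal sum to that of
    each coefficient, whose two parts are separated by the framing variable,
    [T] having constant values. *)
Lemma annihilatesP (a1 a2 : coef_field K) (k : 'I_3) g1 g2 g3 p1 p2 p3
    Q1 Q2 Q3 (T : intpart -> intpart -> intpart -> K) :
  let b := framing_var K k in
  let tau (l : triple) := T l.1.1 l.1.2 l.2 in
  a1 != 0 -> a2 != 0 ->
  leg (Wvertex W) (coef s) z a1 g1 p1 Q1 ->
  leg (Wvertex W) (coef s) z a2 g2 p2 Q2 ->
  leg (Wvertex W) (coef s) z b g3 p3 Q3 ->
  annihilates W (vertex_operator b a1 a2 Q1 Q2 Q3) T <->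
  forall l,
    schur_box s (conj_part (g2 l)) * tau l =
      \sum_(m \in rem_box (g1 l)) tau (p1 l m) -
      \sum_(m \in add_box (g3 l)) s ^ (kappa m - kappa (g3 l)) * tau (p3 l m)
    /\
    schur_box s (g1 l) * tau l =
      \sum_(m \in rem_box (g2 l)) s ^ (kappa m - kappa (g2 l)) * tau (p2 l m) -
      \sum_(m \in add_box (g3 l)) tau (p3 l m).
Proof.
move=> b tau a10 a20 L1 L2 L3.
have col := collects_vertex_operator (phi := @coef K) tau z_neq0 a10 a20
  (framing_var_neq0 K k) L1 L2 L3.
pose emb (l : triple) :=
  ((l.1.1, empty_part), (l.1.2, empty_part), (l.2, empty_part)).
apply: iff_trans (formal_sum_eq0P (EE := Wtens W) (emb := emb) _ _ _ col) _.
- move=> x c d; exact: (tens_expansion_uniq (sb_basis (W_basis 0))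
    (sb_basis (W_basis 1)) (sb_basis (W_basis 2))).
- by move=> [[? ?] ?] [[? ?] ?] [-> -> ->].
- by [].
split=> h l; have := h l.
  move/coef_framing_eq0 => [/eqP]; rewrite oppr_eq0.
  by rewrite !subr_eq0 => /eqP -> /eqP; rewrite subr_eq0 => /eqP ->.
move=> [e1 e2]; apply/coef_framing_eq0.
by rewrite /framed_defect /unframed_defect -/(tau l) e1 e2 !subrr oppr0.
Qed.

End Vertex.

Theorem proposition2 (R : realType) (K : fieldType) (s : K)
    (s_neq0 : s != 0) (z_neq0 : s - s^-1 != 0)
    (act : forall k : 'I_3, leg_skein R s thick_torus k ->
       leg_skein R s solid_torus k -> leg_skein R s solid_torus k)
    (act_insertion : forall k, insertion_action (act k))
    (W : forall k : 'I_3, intpart -> intpart -> leg_skein R s solid_torus k)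
    (W_basis : forall k, skein_basis (coef s) (act k) (W k))
    (T : intpart -> intpart -> intpart -> K) :
  [/\ annihilates W (A1 act) T <->
      forall l1 l2 l3 : intpart,
        schur_box s (conj_part l2) * T l1 l2 l3 =
          \sum_(m1 \in rem_box l1) T m1 l2 l3 -
          \sum_(m3 \in add_box l3) s ^ (kappa m3 - kappa l3) * T l1 l2 m3
        /\
        schur_box s l1 * T l1 l2 l3 =
          \sum_(m2 \in rem_box l2) s ^ (kappa m2 - kappa l2) * T l1 m2 l3 -
          \sum_(m3 \in add_box l3) T l1 l2 m3,
      annihilates W (A2 act) T <->
      forall l1 l2 l3 : intpart,
        schur_box s (conj_part l3) * T l1 l2 l3 =
          \sum_(m2 \in rem_box l2) T l1 m2 l3 -
          \sum_(m1 \in add_box l1) s ^ (kappa m1 - kappa l1) * T m1 l2 l3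
        /\
        schur_box s l2 * T l1 l2 l3 =
          \sum_(m3 \in rem_box l3) s ^ (kappa m3 - kappa l3) * T l1 l2 m3 -
          \sum_(m1 \in add_box l1) T m1 l2 l3
    & annihilates W (A3 act) T <->
      forall l1 l2 l3 : intpart,
        schur_box s (conj_part l1) * T l1 l2 l3 =
          \sum_(m3 \in rem_box l3) T l1 l2 m3 -
          \sum_(m2 \in add_box l2) s ^ (kappa m2 - kappa l2) * T l1 m2 l3
        /\
        schur_box s l3 * T l1 l2 l3 =
          \sum_(m1 \in rem_box l1) s ^ (kappa m1 - kappa l1) * T m1 l2 l3 -
          \sum_(m2 \in add_box l2) T l1 m2 l3].
Proof.
have a0 k : framing_var K k != 0 := framing_var_neq0 K k.
have L0 := leg0 act_insertion W_basis.
have L1 := leg1 act_insertion W_basis.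
have L2 := leg2 act_insertion W_basis.
have triples (Q : intpart * intpart * intpart -> Prop) :
    (forall l, Q l) <-> (forall l1 l2 l3, Q (l1, l2, l3)).
  by split=> [h l1 l2 l3|h [[l1 l2] l3]]; exact: h.
split.
- exact: iff_trans
    (annihilatesP z_neq0 W_basis T (a0 0) (a0 1) L0 L1 L2) (triples _).
- exact: iff_trans
    (annihilatesP z_neq0 W_basis T (a0 1) (a0 2) L1 L2 L0) (triples _).
- exact: iff_trans
    (annihilatesP z_neq0 W_basis T (a0 2) (a0 0) L2 L0 L1) (triples _).
Qed.
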